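(* Let $S$ be a finite commutative ai-semiring satisfying the identity $xy+x\approx xy$ and possessing a multiplicative identity element. Then $S$ is finitely based in the signature $(2,2)$. If $|S|=d+1>1$, then a finite basis for the identities of $S$ can be chosen whose identities, apart from the commutative ai-semiring axioms, involve at most $d+1$ variables.
   Context: An additively idempotent semiring (ai-semiring) is an algebra $(S,+,\cdot)$ of signature $(2,2)$, without constants, such that $(S,+)$ is a commutative idempotent semigroup, $(S,\cdot)$ is a semigroup, and multiplication distributes over addition. It is commutative if its multiplication is commutative. The multiplicative identity is an element of $S$ and is not part of the signature. An algebra is finitely based if the variety it generates can be defined by finitely many identities. *)

(* Defs.v *)
From Stdlib Require List.
From mathcomp Require Import all_boot.

Set Implicit Arguments.
Unset Strict Implicit.
Unset Printing Implicit Defensive.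

(* Algebras of signature (2,2).  The empty carrier is not excluded: with no
   constants in the signature, the empty algebra satisfies every identity and
   belongs to every variety, so it affects neither equational
   consequence nor the question of which identities define a given variety. *)
Record algebra : Type := Algebra {
  carrier :> Type;
  plus : carrier -> carrier -> carrier;
  times : carrier -> carrier -> carrier
}.

Inductive term : Type :=
  | Var of nat
  | Plus of term & term
  | Times of term & term.

Record identity : Type := Identity { lhs : term; rhs : term }.

Declare Scope term_scope.
Delimit Scope term_scope with term.
Bind Scope term_scope with term.
Notation "s + t" := (Plus s t) : term_scope.
Notation "s * t" := (Times s t) : term_scope.
Notation "s ≈ t" := (Identity s%term t%term) (at level 70, no associativity).

Fixpoint eval (A : algebra) (v : nat -> A) (t : term) : A :=
  match t with
  | Var i => v i
  | Plus s u => plus (eval v s) (eval v u)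
  | Times s u => times (eval v s) (eval v u)
  end.

Definition holds (A : algebra) (e : identity) : Prop :=
  forall v : nat -> A, eval v (lhs e) = eval v (rhs e).

Definition satisfies (A : algebra) (E : seq identity) : Prop :=
  List.Forall (holds A) E.

Fixpoint vars (t : term) : seq nat :=
  match t with
  | Var i => [:: i]
  | Plus s u | Times s u => vars s ++ vars u
  end.

Definition nvars (e : identity) : nat :=
  size (undup (vars (lhs e) ++ vars (rhs e))).

Definition is_hom (A B : algebra) (f : A -> B) : Prop :=
  (forall x y, f (plus x y) = plus (f x) (f y)) /\
  (forall x y, f (times x y) = times (f x) (f y)).

Definition product (I : Type) (A : I -> algebra) : algebra :=
  @Algebra (forall i, A i)
    (fun x y i => plus (x i) (y i))
    (fun x y i => times (x i) (y i)).

(* Subalgebras are taken up to isomorphism, i.e. as embeddings. *)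
Definition is_variety (K : algebra -> Prop) : Prop :=
  [/\ forall (A B : algebra) (f : A -> B),
        is_hom f -> (forall y, exists x, f x = y) -> K A -> K B,
      forall (A B : algebra) (f : A -> B),
        is_hom f -> injective f -> K B -> K A
    & forall (I : Type) (A : I -> algebra),
        (forall i, K (A i)) -> K (product A)].

Definition generated_variety (A B : algebra) : Prop :=
  forall K : algebra -> Prop, is_variety K -> K A -> K B.

Definition finitely_based (A : algebra) : Prop :=
  exists E : seq identity,
    forall B : algebra, generated_variety A B <-> satisfies B E.

Definition consequence (E : seq identity) (e : identity) : Prop :=
  forall B : algebra, satisfies B E -> holds B e.

Definition is_basis (A : algebra) (E : seq identity) : Prop :=
  forall e : identity, holds A e <-> consequence E e.

Definition comm_ai_axioms : seq identity :=
  let x := Var 0 in let y := Var 1 in let z := Var 2 in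
  [:: (x + y) + z ≈ x + (y + z);
      x + y ≈ y + x;
      x + x ≈ x;
      (x * y) * z ≈ x * (y * z);
      x * y ≈ y * x;
      x * (y + z) ≈ x * y + x * z;
      (x + y) * z ≈ x * z + y * z].

Definition comm_ai_semiring (A : algebra) : Prop :=
  satisfies A comm_ai_axioms.

Definition is_mul_identity (A : algebra) (e : A) : Prop :=
  forall x : A, times e x = x /\ times x e = x.

(* Main.v *)
Require Import Defs.
From mathcomp Require Import all_boot.
From mathcomp Require Import boolp.

(** In [S] the law [xy + x = xy] makes multiplication inflationary for the
    order [x <= y :<-> x + y = y], and hence makes the multiplicative identity
    the least element.  So every identity amounts to inequalities
    [w <= u_1 + ... + u_k] between a monomial and a sum of monomials, and if
    [|S| = d + 1] the partial products of a monomial form a chain with at most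
    [d] strict steps.  Factors that give no strict step can be dropped
    ([finite_le_cut]): each monomial is bounded by the sum of its submonomials
    of degree at most [d].  The instance [x_0...x_d <= sum] of this fact is an
    inequality in [d + 1] variables, and it implies the same bound for all
    monomials ([B_cut]).

    Given a valid inequality [w <= u_1 + ... + u_k], it is therefore enough to
    derive those where [deg w <= d].  Putting the unit for the variables that
    do not occur in [w], and then cutting the [u_i] down to degree at most [d],
    gives an inequality that is still valid in [S] and whose right side is
    smaller in every model of the inflationary law ([transfer_short]).  It has
    at most [d] variables and its monomials have degree at most [d], so up to
    renaming only finitely many such inequalities exist.

    Models of the identities need not have a unit.  A commutative ai-semiring
    with [xy + x = xy] embeds in one where a new element is both the least
    element and the multiplicative identity ([adjoin_integral]), so the
    computations may use empty words and empty sums.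

    A finite basis in the sense of equational consequence yields a finite
    basis of the generated variety by Birkhoff's theorem ([birkhoff]). *)

Set Implicit Arguments.
Unset Strict Implicit.
Unset Printing Implicit Defensive.

(** * Birkhoff's theorem *)

Lemma hom_eval (A B : algebra) (f : A -> B) (v : nat -> A) (t : term) :
  is_hom f -> f (eval v t) = eval (f \o v) t.
Proof.
by case=> fD fM; elim: t => //= s <- u <-; rewrite ?fD ?fM.
Qed.

Lemma eval_product (I : Type) (A : I -> algebra) (v : nat -> product A)
    (t : term) (i : I) :
  eval v t i = eval (fun n => v n i) t.
Proof. by elim: t => //= s -> u ->. Qed.

Lemma models_variety (E : seq identity) : is_variety (fun A => satisfies A E).
Proof.
split.
- move=> A B f fhom fsurj; apply: List.Forall_impl => e he v.
  have [g gK] := choice fsurj.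
  have -> : v = f \o (g \o v) by apply: funext => i /=; rewrite gK.
  by rewrite -!(hom_eval _ _ fhom) he.
- move=> A B f fhom finj; apply: List.Forall_impl => e he v.
  by apply: finj; rewrite !(hom_eval _ _ fhom) he.
- move=> I A; elim: E => [|e E IH] hE; first exact: List.Forall_nil.
  apply: List.Forall_cons.
    move=> v; apply: functional_extensionality_dep => i.
    by rewrite !eval_product; exact: (List.Forall_inv (hE i)).
  by apply: IH => i; exact: (List.Forall_inv_tail (hE i)).
Qed.

Fixpoint rename (r : nat -> nat) (t : term) : term :=
  match t with
  | Var i => Var (r i)
  | Plus s u => Plus (rename r s) (rename r u)
  | Times s u => Times (rename r s) (rename r u)
  end.

Lemma eval_rename (A : algebra) (v : nat -> A) (r : nat -> nat) (t : term) :
  eval v (rename r t) = eval (v \o r) t.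
Proof. by elim: t => //= s -> u ->. Qed.

(** Two valuations are merged into one so that two terms evaluated
    separately can be compared inside a single identity. *)
Definition interleave (T : Type) (v w : nat -> T) (n : nat) : T :=
  if odd n then w n./2 else v n./2.

Lemma interleave_even (T : Type) (v w : nat -> T) :
  interleave v w \o double =1 v.
Proof. by move=> n; rewrite /interleave /= odd_double doubleK. Qed.

Lemma interleave_odd (T : Type) (v w : nat -> T) :
  interleave v w \o (succn \o double) =1 w.
Proof.
by move=> n; rewrite /interleave /= odd_double /= uphalf_double.
Qed.

Section Birkhoff.

Variables A B : algebra.
Hypothesis AB : forall e, holds A e -> holds B e.

Definition power : algebra := product (fun _ : B -> A => A).

(** The graph of the relation between the subalgebra of [A ^ (A ^ B)]
    generated by the projections and its intended image [B]. *)
Definition represents (g : power) (b : B) : Prop :=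
  exists (t : term) (v : nat -> B),
    (forall h, g h = eval (h \o v) t) /\ b = eval v t.

(** Distinct variables may take the same value in [B], while a valuation in [A]
    need not respect this.  Renaming each variable to one chosen representative
    of its value makes every valuation in [A] of the renamed variables factor
    through [B]. *)
Lemma common_valuation (v v' : nat -> B) :
  exists w r r', [/\ w \o r = v, w \o r' = v' &
    forall u : nat -> A, exists h : B -> A, u \o r = h \o v /\ u \o r' = h \o v'].
Proof.
pose w := interleave v v'.
have [rep repP] : exists rep : B -> nat, forall n, w (rep (w n)) = w n.
  have /choice [rep repP] : forall b, exists n, (exists m, w m = b) -> w n = b.
    move=> b; have [[m mb]|nb] := pselect (exists m, w m = b); first by exists m.
    by exists 0 => /nb.
  by exists rep => n; apply: repP; exists n.
exists w, (rep \o v), (rep \o v'); split.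
- by apply: funext => n /=; rewrite -(interleave_even v v') /= repP.
- by apply: funext => n /=; rewrite -(interleave_odd v v') /= repP.
- by move=> u; exists (u \o rep); split.
Qed.

Lemma represents_fun g b b' : represents g b -> represents g b' -> b = b'.
Proof.
move=> [t [v [gt ->]]] [t' [v' [gt' ->]]].
have [w [r [r' [wr wr' hA]]]] := common_valuation v v'.
rewrite -wr -wr' -(eval_rename w r) -(eval_rename w r').
apply: (AB (e := Identity (rename r t) (rename r' t'))) => u /=.
by rewrite !eval_rename; have [h [-> ->]] := hA u; rewrite -gt -gt'.
Qed.

Lemma represents_op (op : term -> term -> term)
    (opA : A -> A -> A) (opB : B -> B -> B) g g' b b' :
  (forall (v : nat -> A) s u, eval v (op s u) = opA (eval v s) (eval v u)) ->
  (forall (v : nat -> B) s u, eval v (op s u) = opB (eval v s) (eval v u)) ->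
  represents g b -> represents g' b' ->
  represents (fun h => opA (g h) (g' h)) (opB b b').
Proof.
move=> eA eB [t [v [gt ->]]] [t' [v' [gt' ->]]].
have [w [r [r' [wr wr' _]]]] := common_valuation v v'.
exists (op (rename r t) (rename r' t')), w; split=> [h|].
  by rewrite eA gt gt' !eval_rename -wr -wr'.
by rewrite eB !eval_rename wr wr'.
Qed.

Lemma represents_plus g g' b b' :
  represents g b -> represents g' b' -> represents (plus g g') (plus b b').
Proof. exact: (represents_op (op := Plus)). Qed.

Lemma represents_times g g' b b' :
  represents g b -> represents g' b' -> represents (times g g') (times b b').
Proof. exact: (represents_op (op := Times)). Qed.

(** The generated subalgebra of the power, carried by pairs so that the map onto
    [B] is a projection and no term has to be chosen for an element. *)
Definition generic : Type := {gb : power * B | represents gb.1 gb.2}.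

Definition generic_plus (x y : generic) : generic :=
  exist _ (plus (sval x).1 (sval y).1, plus (sval x).2 (sval y).2)
    (represents_plus (svalP x) (svalP y)).

Definition generic_times (x y : generic) : generic :=
  exist _ (times (sval x).1 (sval y).1, times (sval x).2 (sval y).2)
    (represents_times (svalP x) (svalP y)).

(** [B] is the image of [generic] under the second projection, and the first
    projection embeds [generic] in a power of [A], because [represents] is
    functional. *)
Theorem birkhoff : generated_variety A B.
Proof.
move=> K [Kim Ksub Kprod] KA.
pose F := Algebra generic_plus generic_times.
suff KF : K F.
  apply: (Kim F B (fun x => (sval x).2)) KF => // b.
  have rb : represents (fun h => h b) b by exists (Var 0), (fun=> b).
  by exists (exist _ (_, b) rb).
apply: (Ksub F power (fun x => (sval x).1)) => //; last exact: Kprod.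
move=> [[g b] gb] [[g' b'] gb'] /= egg'.
by apply: eq_exist; congr pair => //; apply: (represents_fun gb); rewrite egg'.
Qed.

End Birkhoff.

Lemma basis_finitely_based (A : algebra) (E : seq identity) :
  is_basis A E -> finitely_based A.
Proof.
move=> AE; exists E => B; split.
  move=> AB; apply: (AB _ (models_variety E)).
  apply/List.Forall_forall => e eE; apply/AE => C /List.Forall_forall; exact.
by move=> BE; apply: birkhoff => e /AE; apply.
Qed.

(** * Semirings whose unit is the least element *)

(** One element is neutral for both operations.  This gives
    [xy + x = x(y + 1) = xy], so it contains the inflationary law. *)
Record integral_semiring (M : algebra) (one : M) : Prop := IntegralSemiring {
  plusA : associative (@plus M);
  plusC : commutative (@plus M);
  plusxx : idempotent_op (@plus M);
  timesA : associative (@times M);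
  timesC : commutative (@times M);
  timesDr : right_distributive (@times M) (@plus M);
  plus1 : left_id one (@plus M);
  times1 : left_id one (@times M)
}.

Definition le (M : algebra) (x y : M) : Prop := plus x y = y.

Fixpoint sublists (T : Type) (s : seq T) : seq (seq T) :=
  if s is x :: s' then [seq x :: t | t <- sublists s'] ++ sublists s'
  else [:: [::]].

Lemma mem_sublists (T : eqType) (s t : seq T) :
  (t \in sublists s) = subseq t s.
Proof.
elim: s t => [|x s IH] t /=; first by rewrite inE; case: t.
rewrite mem_cat IH; case: t => [|y t]; first by rewrite sub0seq orbT.
have [->|nyx] := eqVneq y x.
  apply/orP/idP => [[/mapP[u]|]|ts].
  - by rewrite IH => us [->].
  - exact: cons_subseq.
  - by left; apply: map_f; rewrite IH.
case: mapP => // -[u _ [yx _]].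
by rewrite yx eqxx in nyx.
Qed.

Definition cut (d : nat) (w : seq nat) : seq (seq nat) :=
  [seq u <- sublists w | size u <= d].

Lemma mem_cut d w u : (u \in cut d w) = (size u <= d) && subseq u w.
Proof. by rewrite mem_filter mem_sublists. Qed.

(** In the product clause the two summands [expand s] and [expand u] are harmless
    because [x <= xy]; they account for the least element that [poly_val] adds
    to each sum, as [(1 + p)(1 + q) = 1 + p + q + pq]. *)
Fixpoint expand (t : term) : seq (seq nat) :=
  match t with
  | Var i => [:: [:: i]]
  | Plus s u => expand s ++ expand u
  | Times s u =>
    expand s ++ expand u ++ [seq a ++ b | a <- expand s, b <- expand u]
  end.

(** The terms have no constants, so only nonempty words and sums have an honest
    term; on the empty word the default is [Var 0]. *)
Definition word_term (w : seq nat) : term :=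
  (fix go i w := if w is j :: w' then Times (Var i) (go j w') else Var i)
    (head 0 w) (behead w).

Definition poly_term (p : seq (seq nat)) : term :=
  (fix go w p :=
     if p is u :: p' then Plus (word_term w) (go u p') else word_term w)
    (head [::] p) (behead p).

Definition inequality (w : seq nat) (p : seq (seq nat)) : identity :=
  Identity (Plus (word_term w) (poly_term p)) (poly_term p).

Section Integral.

Variables (M : algebra) (one : M).
Hypothesis hM : integral_semiring one.

Local Notation "x <=' y" := (le x y) (at level 70).

Implicit Types (x y z : M).

Lemma le_refl x : x <=' x. Proof. exact: (plusxx hM). Qed.

Lemma le_trans y x z : x <=' y -> y <=' z -> x <=' z.
Proof. by move=> xy yz; rewrite /le -yz (plusA hM) xy. Qed.

Lemma le_antisym x y : x <=' y -> y <=' x -> x = y.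
Proof. by move=> xy <-; rewrite (plusC hM) xy. Qed.

Lemma le1 x : one <=' x. Proof. exact: (plus1 hM). Qed.

Lemma plus_le x y z : plus x y <=' z <-> x <=' z /\ y <=' z.
Proof.
split=> [h|[xz yz]]; last by rewrite /le -(plusA hM) yz.
split; apply: le_trans h; rewrite /le (plusA hM) ?(plusxx hM) //.
by rewrite (plusC hM y) -(plusA hM) (plusxx hM).
Qed.

Lemma le_plus_l x y : x <=' plus x y.
Proof. by have /plus_le[] := le_refl (plus x y). Qed.

Lemma le_plus_r x y : y <=' plus x y.
Proof. by have /plus_le[] := le_refl (plus x y). Qed.

Lemma timesDl : left_distributive (@times M) (@plus M).
Proof. by move=> x y z; rewrite !(timesC hM _ z) (timesDr hM). Qed.

Lemma times_le x y x' y' : x <=' x' -> y <=' y' -> times x y <=' times x' y'.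
Proof.
move=> xx' yy'; apply: (@le_trans (times x' y)).
  by rewrite /le -timesDl xx'.
by rewrite /le -(timesDr hM) yy'.
Qed.

Lemma le_times_l x y : x <=' times x y.
Proof.
rewrite -{1}(times1 hM x) (timesC hM).
by apply: times_le; [apply: le_refl|apply: le1].
Qed.

Lemma le_times_r x y : y <=' times x y.
Proof. by rewrite (timesC hM); apply: le_times_l. Qed.

Implicit Types (v : nat -> M) (w u : seq nat) (p q : seq (seq nat)).

(** The fold starts from [one], which is neutral for both operations: the empty
    word has value [one], and so has the empty sum, as least element. *)
Definition word_val v w : M := foldr (fun i x => times (v i) x) one w.

Definition poly_val v p : M := foldr (fun w x => plus (word_val v w) x) one p.

Lemma word_val_cat v w u :
  word_val v (w ++ u) = times (word_val v w) (word_val v u).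
Proof.
elim: w => [|i w /= ->] /=; first by rewrite (times1 hM).
by rewrite (timesA hM).
Qed.

Lemma word_val_map v (r : nat -> nat) w :
  word_val v (map r w) = word_val (v \o r) w.
Proof. by elim: w => //= i w ->. Qed.

Lemma poly_val_map v (r : nat -> nat) p :
  poly_val v (map (map r) p) = poly_val (v \o r) p.
Proof. by elim: p => //= w p ->; rewrite word_val_map. Qed.

Lemma eq_word_val v v' w : {in w, v =1 v'} -> word_val v w = word_val v' w.
Proof.
elim: w => //= i w IH e; rewrite e ?mem_head // IH // => j jw.
by apply: e; rewrite inE jw orbT.
Qed.

Lemma eq_poly_val v v' p :
  (forall w, w \in p -> {in w, v =1 v'}) -> poly_val v p = poly_val v' p.
Proof.
elim: p => //= w p IH e; rewrite (eq_word_val (e w _)) ?mem_head // IH // => u up.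
by apply: e; rewrite inE up orbT.
Qed.

Lemma word_val_filter v (a : pred nat) w :
  word_val v (filter a w) = word_val (fun i => if a i then v i else one) w.
Proof. by elim: w => //= i w <-; case: ifP; rewrite ?(times1 hM). Qed.

Lemma word_val_subseq v w u : subseq u w -> word_val v u <=' word_val v w.
Proof.
elim: w u => [|i w IH] [|j u] //= uw; try exact: le1; try exact: le_refl.
move: uw; case: eqP => [->|_] uw; first by apply: times_le (IH _ uw); apply: le_refl.
by apply: le_trans (IH _ uw) _; apply: le_times_r.
Qed.

Lemma poly_val_le v p x :
  (forall w, w \in p -> word_val v w <=' x) -> poly_val v p <=' x.
Proof.
elim: p => [|w p IH] h /=; first exact: le1.
apply/plus_le; split; first by apply: h; rewrite mem_head.
by apply: IH => u up; apply: h; rewrite inE up orbT.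
Qed.

Lemma le_poly_val v p w : w \in p -> word_val v w <=' poly_val v p.
Proof.
elim: p => //= u p IH; rewrite inE => /predU1P[->|/IH h]; first exact: le_plus_l.
exact: le_trans h (le_plus_r _ _).
Qed.

Lemma poly_val_sub v p q : {subset p <= q} -> poly_val v p <=' poly_val v q.
Proof. by move=> pq; apply: poly_val_le => w /pq; apply: le_poly_val. Qed.

Lemma poly_val_times_le v p x y :
  y <=' x -> (forall w, w \in p -> times (word_val v w) y <=' x) ->
  times (poly_val v p) y <=' x.
Proof.
move=> yx; elim: p => [|w p IH] h /=; first by rewrite (times1 hM).
rewrite timesDl; apply/plus_le; split; first by apply: h; rewrite mem_head.
by apply: IH => u up; apply: h; rewrite inE up orbT.
Qed.

Lemma eval_expand v t : eval v t = poly_val v (expand t).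
Proof.
elim: t => [i|s IHs u IHu|s IHs u IHu] /=.
- by rewrite (timesC hM) (times1 hM) (plusC hM) (plus1 hM).
- rewrite IHs IHu; apply: le_antisym.
    by apply/plus_le; split; apply: poly_val_sub => w wp; rewrite mem_cat wp ?orbT.
  apply: poly_val_le => w; rewrite mem_cat => /orP[] wp.
    by apply: le_trans (le_poly_val v wp) _; apply: le_plus_l.
  by apply: le_trans (le_poly_val v wp) _; apply: le_plus_r.
rewrite IHs IHu; apply: le_antisym.
  apply: poly_val_times_le.
    by apply: poly_val_sub => w wp; rewrite !mem_cat wp orbT.
  move=> a ap; rewrite (timesC hM); apply: poly_val_times_le.
    by apply: le_poly_val; rewrite mem_cat ap.
  move=> b bp; rewrite (timesC hM) -word_val_cat; apply: le_poly_val.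
  by rewrite !mem_cat allpairs_f ?orbT.
apply: poly_val_le => w; rewrite !mem_cat => /or3P[wp|wp|/allpairsP[[a b] [/= ap bp ->]]].
- by apply: le_trans (le_poly_val v wp) _; apply: le_times_l.
- by apply: le_trans (le_poly_val v wp) _; apply: le_times_r.
- by rewrite word_val_cat; apply: times_le; apply: le_poly_val.
Qed.

Lemma eval_word_term v w : w != [::] -> eval v (word_term w) = word_val v w.
Proof.
case: w => // i w _; rewrite /word_term /=.
elim: w i => [|j w IH] i /=; first by rewrite (timesC hM) (times1 hM).
by rewrite IH.
Qed.

Lemma eval_poly_term v p :
  p != [::] -> [::] \notin p -> eval v (poly_term p) = poly_val v p.
Proof.
case: p => // w p _; rewrite /poly_term /=.
elim: p w => [|u p IH] w /=; rewrite in_cons eq_sym negb_or => /andP[w0 p0].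
  by rewrite eval_word_term // (plusC hM) (plus1 hM).
by rewrite IH // eval_word_term.
Qed.

Lemma holds_inequality w p : w != [::] -> p != [::] -> [::] \notin p ->
  holds M (inequality w p) <-> forall v, word_val v w <=' poly_val v p.
Proof.
by move=> w0 p0 np; split=> h v; have := h v; rewrite /= eval_word_term ?eval_poly_term.
Qed.

End Integral.

(** * Adjoining a unit *)

Lemma comm_ai_laws (A : algebra) : comm_ai_semiring A ->
  [/\ associative (@plus A), commutative (@plus A) & idempotent_op (@plus A)] /\
  [/\ associative (@times A), commutative (@times A)
    & right_distributive (@times A) (@plus A)].
Proof.
rewrite /comm_ai_semiring /satisfies !List.Forall_cons_iff.
move=> [pA [pC [pp [tA [tC [tD _]]]]]].
pose v (x y z : A) := nth x [:: x; y; z].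
do 2!split; move=> x.
- by move=> y z; symmetry; apply: (pA (v x y z)).
- by move=> y; apply: (pC (v x y x)).
- exact: (pp (v x x x)).
- by move=> y z; symmetry; apply: (tA (v x y z)).
- by move=> y; apply: (tC (v x y x)).
- by move=> y z; apply: (tD (v x y z)).
Qed.

Definition inflationary_law : identity :=
  Var 0 * Var 1 + Var 0 ≈ Var 0 * Var 1.

Lemma integral_unit (A : algebra) (one : A) :
  comm_ai_semiring A -> holds A inflationary_law ->
  is_mul_identity one -> integral_semiring one.
Proof.
move=> /comm_ai_laws[[pA pC pp] [tA tC tD]] hle h1.
have t1 : left_id one (@times A) by move=> x; case: (h1 x).
split=> // x; have /= := hle (nth one [:: one; x]).
by rewrite t1 pC.
Qed.

Section Adjoin.

Variable B : algebra.

Definition adjoin_plus (x y : option B) : option B :=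
  match x, y with
  | None, _ => y
  | _, None => x
  | Some a, Some b => Some (plus a b)
  end.

Definition adjoin_times (x y : option B) : option B :=
  match x, y with
  | None, _ => y
  | _, None => x
  | Some a, Some b => Some (times a b)
  end.

Definition adjoin : algebra := Algebra adjoin_plus adjoin_times.

(** Distributivity at the new unit is where the inflationary law enters:
    [x(1 + z) = xz] must agree with [x1 + xz = x + xz]. *)
Lemma adjoin_integral :
  comm_ai_semiring B -> holds B inflationary_law ->
  integral_semiring (None : adjoin).
Proof.
move=> /comm_ai_laws[[pA pC pp] [tA tC tD]] hle.
have absorb x y : plus (times x y) x = times x y := hle (nth x [:: x; y]).
split=> /=.
- by move=> [x|] [y|] [z|] //=; rewrite pA.
- by move=> [x|] [y|] //=; rewrite pC.
- by move=> [x|] //=; rewrite pp.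
- by move=> [x|] [y|] [z|] //=; rewrite tA.
- by move=> [x|] [y|] //=; rewrite tC.
- by move=> [x|] [y|] [z|] //=; rewrite ?tD ?pp ?absorb // pC absorb.
- by case.
- by case.
Qed.

Lemma Some_hom : is_hom (Some : B -> adjoin).
Proof. by []. Qed.

End Adjoin.

(** * Words of bounded length suffice *)

(** Multiplying by one more letter either leaves the value unchanged, and the
    letter is dropped, or enlarges the set of elements below it.  The value is
    thus attained by a subword with fewer letters than there are elements below
    it, so with at most [d] letters. *)
Lemma finite_le_cut (S : finType) (add mul : S -> S -> S)
    (one : Algebra add mul) (d : nat) (v : nat -> Algebra add mul) (w : seq nat) :
  integral_semiring one -> #|S| = d.+1 ->
  le (word_val one v w) (poly_val one v (cut d w)).
Proof.
move=> hS cardS.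
pose below (x : S) := [set y : S | add y x == x].
have [u uw [-> ub]] : exists2 u, subseq u w &
    word_val one v w = word_val one v u /\ size u < #|below (word_val one v w)|.
  elim: w => [|i w [u uw [eu ub]]] /=.
    exists [::] => //; split=> //; apply/card_gt0P; exists one.
    by rewrite inE; apply/eqP/(plus1 hS one).
  have le_iw := le_times_r hS (v i) (word_val one v w).
  have [e|ne] := eqVneq (mul (v i) (word_val one v w)) (word_val one v w).
    exists u; first exact: subseq_trans uw (subseq_cons _ _).
    by rewrite /= e.
  exists (i :: u); first by rewrite /= eqxx.
  split; first by rewrite /= eu.
  apply: leq_trans (proper_card _); first exact: ub.
  apply/properP; split.
    apply/subsetP=> y; rewrite !inE => /eqP yw; apply/eqP.
    exact: (le_trans hS yw le_iw).
  exists (mul (v i) (word_val one v w)); first by rewrite inE; apply/eqP/(le_refl hS).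
  rewrite inE; apply/negP => /eqP iw_le; case/eqP: ne.
  exact: (le_antisym hS iw_le le_iw).
apply: le_poly_val => //; rewrite mem_cut uw andbT -ltnS -cardS.
exact: leq_trans ub (max_card _).
Qed.

(** * The finite basis *)

Fixpoint words (n k : nat) : seq (seq nat) :=
  if k is k'.+1 then [::] :: [seq i :: w | i <- iota 0 n, w <- words n k']
  else [:: [::]].

Lemma mem_words n k w :
  (w \in words n k) = (size w <= k) && all (fun i => i < n) w.
Proof.
elim: k w => [|k IH] [|i w] //=; rewrite in_cons /= ltnS.
apply/allpairsP/and3P => [[[j u] /= [jn uk [-> ->]]]|[wk i_n wn]].
  by move: jn uk; rewrite mem_iota IH => /= -> /andP[].
by exists (i, w) => /=; rewrite mem_iota IH wk.
Qed.

Definition nonempty_words (n : nat) : seq (seq nat) :=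
  [seq w <- words n n | w != [::]].

(** Letters and lengths both reach [n]: with [n = d + 1] the family contains the
    reduction [x_0...x_d <= sum] as well as all inequalities in [d] variables
    and degree at most [d]. *)
Definition valid_inequalities (A : algebra) (n : nat) : seq identity :=
  [seq inequality wp.1 wp.2 | wp <-
    [seq wp <- [seq (w, p) | w <- nonempty_words n,
                             p <- sublists (nonempty_words n)]
       | `[< holds A (inequality wp.1 wp.2) >] ]].

Lemma satisfies_map (T : eqType) (A : algebra) (f : T -> identity) (s : seq T) :
  satisfies A (map f s) <-> forall x, x \in s -> holds A (f x).
Proof.
elim: s => [|x s IH]; first by split=> // _; apply: List.Forall_nil.
rewrite /= /satisfies List.Forall_cons_iff; split=> [[hx /IH hs] y|h].
  by rewrite inE => /predU1P[->|/hs].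
split; first by apply: h; rewrite mem_head.
by apply/IH => y ys; apply: h; rewrite inE ys orbT.
Qed.

Lemma satisfies_cat (A : algebra) (E F : seq identity) :
  satisfies A (E ++ F) <-> satisfies A E /\ satisfies A F.
Proof. exact: List.Forall_app. Qed.

Lemma satisfies_valid_inequalities (A : algebra) n :
  satisfies A (valid_inequalities A n).
Proof. by apply/satisfies_map => wp; rewrite mem_filter => /andP[/asboolP]. Qed.

(** Positivity of [n] covers the default [Var 0]. *)
Lemma vars_word_term n w : 0 < n -> all (fun i => i < n) w ->
  all (fun i => i < n) (vars (word_term w)).
Proof.
case: w => [|i w] n0 /=; first by rewrite /word_term /= n0.
rewrite /word_term /=; elim: w i => [|j w IH] i /=; first by rewrite andbT.
by case/and3P=> -> jn wn; apply: IH; rewrite jn.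
Qed.

Lemma vars_poly_term n p : 0 < n -> (forall w, w \in p -> all (fun i => i < n) w) ->
  all (fun i => i < n) (vars (poly_term p)).
Proof.
move=> n0 h; rewrite /poly_term.
have : all (fun i => i < n) (head [::] p).
  by case: p h => //= w p; apply; rewrite mem_head.
have : forall w, w \in behead p -> all (fun i => i < n) w.
  by move=> w /mem_behead; apply: h.
elim: (behead p) (head [::] p) => [|u q IH] w /= hq wn.
  exact: vars_word_term.
rewrite all_cat vars_word_term //; apply: IH; last by apply: hq; rewrite mem_head.
by move=> u' uq; apply: hq; rewrite inE uq orbT.
Qed.

Lemma nvars_le n e :
  all (fun i => i < n) (vars (lhs e)) -> all (fun i => i < n) (vars (rhs e)) ->
  nvars e <= n.
Proof.
move=> hl hr; rewrite /nvars -(size_iota 0 n); apply: uniq_leq_size (undup_uniq _) _.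
move=> i; rewrite mem_undup mem_iota /= add0n mem_cat => /orP[].
  exact: (allP hl).
exact: (allP hr).
Qed.

Lemma nvars_valid_inequalities (A : algebra) n : 0 < n ->
  all (fun e => nvars e <= n) (valid_inequalities A n).
Proof.
move=> n0; rewrite all_map; apply/allP => wp; rewrite mem_filter => /andP[_].
case/allpairsP=> -[w p] [/= wn]; rewrite mem_sublists => /mem_subseq pn ->.
have ltn_word u : u \in nonempty_words n -> all (fun i => i < n) u.
  by rewrite mem_filter mem_words => /and3P[].
have pvars : all (fun i => i < n) (vars (poly_term p)).
  by apply: vars_poly_term => // u /pn; apply: ltn_word.
by apply: nvars_le => //=; rewrite all_cat pvars vars_word_term ?ltn_word.
Qed.

(** * Every valid identity follows from the basis *)

Section Completeness.

Variables (S B : algebra) (one : S) (d : nat).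
Hypothesis hS : integral_semiring one.
Hypothesis S_nontrivial : exists x : S, x <> one.
Hypothesis S_cut : forall v w, le (word_val one v w) (poly_val one v (cut d w)).

Hypothesis B_ai : comm_ai_semiring B.
Hypothesis B_infl : holds B inflationary_law.
Hypothesis B_valid : satisfies B (valid_inequalities S d.+1).

Local Notation one' := (None : adjoin B).
Let hB : integral_semiring one' := adjoin_integral B_ai B_infl.

Definition below_in_S (w : seq nat) (p : seq (seq nat)) : Prop :=
  forall v : nat -> S, le (word_val one v w) (poly_val one v p).

Definition below_in_B (w : seq nat) (p : seq (seq nat)) : Prop :=
  forall v : nat -> B, le (word_val one' (Some \o v) w) (poly_val one' (Some \o v) p).

(** Once empty words are removed and the right side is listed in the order of
    [nonempty_words], such an inequality is a member of the basis.  The right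
    side cannot become empty: then a nonempty product would always be [one] in
    [S], against nontriviality. *)
Lemma transfer_small (w : seq nat) (p : seq (seq nat)) :
  w \in words d.+1 d.+1 -> {subset p <= words d.+1 d.+1} ->
  below_in_S w p -> below_in_B w p.
Proof.
have [-> _ _ _ v|w0 ww pw wp] := eqVneq w [::]; first exact: (le1 hB).
pose q := [seq u <- nonempty_words d.+1 | u \in p].
have qp : {subset q <= p} by move=> u; rewrite mem_filter => /andP[].
have pq u : u \in p -> u = [::] \/ u \in q.
  move=> up; have [->|u0] := eqVneq u [::]; first by left.
  by right; rewrite !mem_filter up u0 pw.
have wq : below_in_S w q.
  move=> v; apply: (le_trans hS (wp v)); apply: (poly_val_le hS) => u /pq[->|].
    exact: (le1 hS).
  exact: (le_poly_val hS).
have q0 : q != [::].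
  apply/eqP => q0; have [x] := S_nontrivial; case.
  apply: (le_antisym hS _ (le1 hS x)).
  have := wq (fun=> x); rewrite q0 /=; case: w w0 {ww wp wq} => // i w _.
  exact: (le_trans hS (le_times_l hS _ _)).
have nq : [::] \notin q by rewrite !mem_filter eqxx andbF.
have valid : holds S (inequality w q) := (holds_inequality hS w0 q0 nq).2 wq.
have in_basis : (w, q) \in [seq wp <- [seq (w, p) | w <- nonempty_words d.+1,
      p <- sublists (nonempty_words d.+1)] | `[< holds S (inequality wp.1 wp.2) >] ].
  rewrite mem_filter; apply/andP; split; first exact/asboolP.
  apply: allpairs_f; first by rewrite mem_filter w0.
  by rewrite mem_sublists filter_subseq.
move=> v; have /= := (satisfies_map _ _ _).1 B_valid _ in_basis v.
move=> /(congr1 (Some : B -> adjoin B)) e.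
apply: (le_trans hB _ (poly_val_sub hB _ qp)).
rewrite -(eval_word_term hB _ w0) -(eval_poly_term hB _ q0 nq).
by rewrite -!(hom_eval _ _ (Some_hom B)).
Qed.

(** The basis contains the case of [d + 1] distinct variables.  Applied to the
    first [d + 1] letters of a longer word it bounds the word by shorter
    subwords, to which induction applies. *)
Lemma B_cut w : below_in_B w (cut d w).
Proof.
move=> v; have [n] := ubnP (size w); elim: n w => // n IH w wn.
have [wd|dw] := leqP (size w) d.
  by apply: (le_poly_val hB); rewrite mem_cut wd subseq_refl.
pose w1 := take d.+1 w; pose w2 := drop d.+1 w.
have size_w1 : size w1 = d.+1 by rewrite size_takel.
have step u : subseq u w -> size u < size w ->
    le (word_val one' (Some \o v) u) (poly_val one' (Some \o v) (cut d w)).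
  move=> uw lt_uw; apply: (le_trans hB (IH u (leq_trans lt_uw wn))).
  apply: (poly_val_sub hB) => t; rewrite !mem_cut => /andP[-> tu].
  exact: subseq_trans uw.
(* The letters of w1 are substituted for the variables 0, ..., d. *)
pose r := nth 0 w1.
have w1E : map r (iota 0 d.+1) = w1 by rewrite -size_w1; apply: mkseq_nth.
have h1 : le (word_val one' (Some \o v) w1)
             (poly_val one' (Some \o v) (map (map r) (cut d (iota 0 d.+1)))).
  rewrite -{1}w1E word_val_map poly_val_map.
  apply: (@transfer_small (iota 0 d.+1) (cut d (iota 0 d.+1)) _ _ _ (v \o r)).
  - by rewrite mem_words size_iota leqnn; apply/allP => i; rewrite mem_iota.
  - move=> u; rewrite mem_cut mem_words => /andP[ud /mem_subseq ui].
    by rewrite (leqW ud); apply/allP => i /ui; rewrite mem_iota.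
  - by move=> u; apply: S_cut.
have wE : w = w1 ++ w2 by rewrite cat_take_drop.
rewrite {1}wE (word_val_cat hB).
apply: (le_trans hB (times_le hB h1 (le_refl hB _))).
apply: (poly_val_times_le hB).
  apply: step; first by rewrite wE suffix_subseq.
  by rewrite wE size_cat size_w1 addSn ltnS leq_addl.
move=> _ /mapP[u + ->]; rewrite mem_cut => /andP[ud ui].
rewrite -(word_val_cat hB); apply: step.
  by rewrite wE cat_subseq // -w1E map_subseq.
by rewrite wE !size_cat size_map size_w1 ltn_add2r ltnS.
Qed.

(** In [S] the variables outside [w] can take the value [one], which erases them
    from [p], and the remaining words can be cut; in [B] each word so obtained
    is a subword of a word of [p], hence below it.  Replacing each letter by its
    position in [w] moves everything to the variables below [d]. *)
Lemma transfer_short w p : size w <= d -> below_in_S w p -> below_in_B w p.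
Proof.
move=> wd wp.
pose q := flatten [seq cut d (filter (mem w) u) | u <- p].
have q_w u : u \in q -> size u <= d /\ {subset u <= w}.
  case/flatten_mapP => t _; rewrite mem_cut => /andP[ud /mem_subseq ut].
  by split=> // i /ut; rewrite mem_filter => /andP[].
have wq : below_in_S w q.
  move=> v; pose v' i := if mem w i then v i else one.
  have -> : word_val one v w = word_val one v' w.
    by apply: eq_word_val => i iw; rewrite /v' /= iw.
  apply: (le_trans hS (wp v')); apply: (poly_val_le hS) => u up.
  rewrite -(word_val_filter hS v (mem w)).
  apply: (le_trans hS (S_cut _ _)); apply: (poly_val_sub hS) => t tu.
  by apply/flatten_mapP; exists u.
pose r := index^~ w.
have small u : size u <= d -> {subset u <= w} -> map r u \in words d.+1 d.+1.
  move=> ud uw; rewrite mem_words size_map (leqW ud) all_map.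
  by apply/allP => i /uw iw /=; rewrite ltnS (leq_trans _ wd) // index_size.
move=> v.
have rK : {in w, (Some \o (v \o nth 0 w)) \o r =1 (Some \o v : nat -> adjoin B)}.
  by move=> i iw; rewrite /= nth_index.
have /(_ (v \o nth 0 w)) : below_in_B (map r w) (map (map r) q).
  apply: transfer_small; first exact: small.
    by move=> _ /mapP[u /q_w[ud uw] ->]; apply: small.
  by move=> u; rewrite word_val_map poly_val_map.
rewrite word_val_map poly_val_map (@eq_word_val (adjoin B) _ _ _ _ rK).
rewrite (@eq_poly_val (adjoin B) _ _ (Some \o v)) => [h|u /q_w[_ uw] i /uw]; last exact: rK.
apply: (le_trans hB h); apply: (poly_val_le hB) => u /flatten_mapP[t tp].
rewrite mem_cut => /andP[_ ut]; apply: (le_trans hB _ (le_poly_val hB _ tp)).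
by apply: (word_val_subseq hB); apply: subseq_trans ut (filter_subseq _ _).
Qed.

(** Inequalities between terms reduce to those with one short word on the left:
    in [B] a word of [s] is bounded by its short subwords, and in [S] each of
    these lies below the word, hence below [t]. *)
Lemma transfer_le s t :
  (forall v : nat -> S, le (eval v s) (eval v t)) ->
  forall v : nat -> B, le (eval v s) (eval v t).
Proof.
move=> st v; suff : le (@eval (adjoin B) (Some \o v) s) (@eval (adjoin B) (Some \o v) t).
  by rewrite -!(hom_eval _ _ (Some_hom B)) => -[].
rewrite !(eval_expand hB); apply: (poly_val_le hB) => w ws.
apply: (le_trans hB (B_cut w v)); apply: (poly_val_le hB) => u.
rewrite mem_cut => /andP[ud uw]; apply: transfer_short => // v'.
apply: (le_trans hS (word_val_subseq hS _ uw)).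
apply: (le_trans hS (le_poly_val hS _ ws)).
by rewrite -!(eval_expand hS).
Qed.

Lemma transfer e : holds S e -> holds B e.
Proof.
have [[_ plusCB _] _] := comm_ai_laws B_ai.
move=> he v; rewrite -(transfer_le (s := rhs e) (t := lhs e) _ v).
  rewrite plusCB; apply: transfer_le => u.
  by rewrite he; apply: (le_refl hS).
by move=> u; rewrite he; apply: (le_refl hS).
Qed.

End Completeness.

Theorem theorem7p1 (S : finType) (add mul : S -> S -> S)
    (hS : comm_ai_semiring (Algebra add mul))
    (hle : holds (Algebra add mul) (Var 0 * Var 1 + Var 0 ≈ Var 0 * Var 1))
    (hone : exists e : Algebra add mul, is_mul_identity e) :
  finitely_based (Algebra add mul) /\
  (forall d : nat, #|S| = d.+1 -> 1 < d.+1 ->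
     exists E : seq identity,
       all (fun e => nvars e <= d.+1) E /\
       is_basis (Algebra add mul) (comm_ai_axioms ++ E)).
Proof.
have [one h1] := hone.
have intS := integral_unit hS hle h1.
have basis d : #|S| = d.+1 -> 1 < d.+1 -> exists E : seq identity,
    all (fun e => nvars e <= d.+1) E /\
    is_basis (Algebra add mul) (comm_ai_axioms ++ E).
  move=> cardS d1.
  exists (inflationary_law :: valid_inequalities (Algebra add mul) d.+1).
  split; first by rewrite /= d1 nvars_valid_inequalities.
  move=> e; split=> [he B|]; last first.
    apply; apply/satisfies_cat; split=> //.
    by apply: List.Forall_cons => //; apply: satisfies_valid_inequalities.
  move=> /satisfies_cat[B_ai /List.Forall_cons_iff[B_infl B_valid]].
  apply: (transfer intS _ _ B_ai B_infl B_valid) he => [|v w].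
    have /card_gt0P[x] : 0 < #|predC1 (one : S)|.
      by rewrite cardC1 cardS.
    by rewrite inE => /eqP nx1; exists x.
  exact: finite_le_cut.
split=> //.
have S0 : 0 < #|S| by apply/card_gt0P; exists one.
(* With one element there is no degree to bound, but x = y is a basis. *)
have [S1|S1] := leqP #|S| 1.
  apply: (@basis_finitely_based _ [:: Var 0 ≈ Var 1]) => e; split=> [_ B hB v|_ v].
    have /= := List.Forall_inv hB (nth (eval v (lhs e)) [:: eval v (lhs e); eval v (rhs e)]).
    by [].
  exact: (fintype_le1P S1).
have [E [_ bE]] := basis #|S|.-1 (esym (prednK S0)) (leq_trans S1 (leqSpred _)).
exact: basis_finitely_based bE.
Qed.
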